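(* Let $u:\mathbb{R}_{\ge 0}\to[0,1]$ be non-increasing with $u(0)=1$ and $\lim_{t\to\infty}u(t)=0$; let there be $n$ algorithms with runtime distributions $\mathcal{D}_i$, CDFs $F_i$, expected utilities $U_i=\mathbb{E}_{t\sim\mathcal{D}_i}[u(t)]$; let $i^{opt}\in\arg\max_iU_i$ and $\Delta_i=U_{i^{opt}}-U_i$; let $\delta\in(0,1)$. Consider the Utilitarian Procrastination (UP) procedure described below. With probability at least $1-\delta$ the following all hold: (1) UP eventually returns the optimal algorithm; (2) if UP returns at the end of a round $m$ in which the current captime $\kappa_{i^{opt}}$ of $i^{opt}$ satisfies $$2\sqrt{\frac{\ln\big(11nm^2(\log\kappa_{i^{opt}}+1)^2/\delta\big)}{2m}}+u(\kappa_{i^{opt}})\big(1-F_{i^{opt}}(\kappa_{i^{opt}})\big)\le\epsilon,$$ then the returned algorithm is $\epsilon$-optimal; (3) for any suboptimal algorithm $i$, if in some round $m$ the current captimes $\kappa_i,\kappa_{i^{opt}}$ satisfy $$2\sqrt{\frac{\ln(11nm^2(\log\kappa_i+1)^2/\delta)}{2m}}+2\sqrt{\frac{\ln(11nm^2(\log\kappa_{i^{opt}}+1)^2/\delta)}{2m}}+u(\kappa_i)\big(1-F_i(\kappa_i)\big)+u(\kappa_{i^{opt}})\big(1-F_{i^{opt}}(\kappa_{i^{opt}})\big)\le\Delta_i,$$ then $i$ is eliminated.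
   Context: Runs of algorithm $i$ at captime $\kappa$ yield independent samples $\min(t,\kappa)$ with $t\sim\mathcal{D}_i$ ($\mathcal{D}_i$ induced by instances drawn i.i.d. from an instance distribution). An algorithm $j$ is $\epsilon$-optimal if $U_j\ge\max_iU_i-\epsilon$. UP procedure: initialize the candidate set $I=\{1,\dots,n\}$ and $\kappa_i=1$ for all $i$. For rounds $m=1,2,3,\dots$: for each $i\in I$, run $i$ on $m$ instances with captime $\kappa_i$, obtaining $t_{i1}(\kappa_i),\dots,t_{im}(\kappa_i)$; let $\widehat{F}_{im}(\kappa_i)=|\{j: t_{ij}(\kappa_i)<\kappa_i\}|/m$, $\widehat{U}_{im}(\kappa_i)=\frac1m\sum_{j=1}^mu(t_{ij}(\kappa_i))$, $\alpha_{im}=\sqrt{\ln(11nm^2(\log\kappa_i+1)^2/\delta)/(2m)}$, $UCB_{im}=\widehat{U}_{im}(\kappa_i)+(1-u(\kappa_i))\alpha_{im}$, $LCB_{im}=\widehat{U}_{im}(\kappa_i)-\alpha_{im}-u(\kappa_i)(1-\widehat{F}_{im}(\kappa_i))$. Then let $i^*\in\arg\max_{i\in I}LCB_{im}$. For each $i\in I$: if $UCB_{im}<LCB_{i^*m}$, remove $i$ from $I$ (''eliminate'' $i$); if $2\alpha_{im}\le u(\kappa_i)(1-\widehat{F}_{im}(\kappa_i))$, set $\kappa_i\leftarrow2\kappa_i$. If $|I|=1$ or execution is interrupted, return $i^*$.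
   Formalization: F_i(κ) is taken as Pr[t<κ], matching the strict count in the empirical F̂, instead of the usual CDF Pr[t≤κ]; with the usual CDF, claim (2) can fail when a runtime has an atom exactly at the captime. *)

(* Defs.v *)
From HB Require Import structures.
From mathcomp Require Import all_boot all_order all_algebra.
From mathcomp Require Import all_classical all_reals all_analysis.
Set Implicit Arguments. Unset Strict Implicit. Unset Printing Implicit Defensive.
Import Order.TTheory GRing.Theory Num.Theory.
Local Open Scope classical_set_scope.
Local Open Scope ring_scope.

Section UP.
Variables (R : realType) (n : nat) (u : R -> R) (delta : R).

Definition exp_util (D : probability R R) : R := fine (\int[D]_t (u t)%:E).

Definition cdf_lt (D : probability R R) (x : R) : R := fine (D `]-oo, x[%classic).

(* captime kappa = 2^k, with k the number of doublings so far; log kappa = k *)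
Definition captime (k : nat) : R := 2 ^+ k.

Definition alpha (m k : nat) : R :=
  Num.sqrt (ln (11 * n%:R * m%:R ^+ 2 * (k%:R + 1) ^+ 2 / delta) / (2 * m%:R)).

(* t i j : uncapped runtime of algorithm i on the j-th instance of the round *)
Definition Fhat (t : 'I_n -> nat -> R) (i : 'I_n) (m k : nat) : R :=
  (\sum_(j < m) (if Num.min (t i j) (captime k) < captime k then 1 else 0)) / m%:R.

Definition Uhat (t : 'I_n -> nat -> R) (i : 'I_n) (m k : nat) : R :=
  (\sum_(j < m) u (Num.min (t i j) (captime k))) / m%:R.

Definition UCB t i m k : R := Uhat t i m k + (1 - u (captime k)) * alpha m k.
Definition LCB t i m k : R :=
  Uhat t i m k - alpha m k - u (captime k) * (1 - Fhat t i m k).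

Record up_state := UPState {
  cand : {set 'I_n};
  kexp : 'I_n -> nat;       (* kappa_i = 2 ^ kexp i *)
  ret : option 'I_n;        (* the current i^* (value returned if interrupted) *)
  stopped : bool }.

Definition up_init : up_state := UPState [set: 'I_n] (fun _ => 0%N) None false.

(* sel I f : the chosen element of argmax_{i in I} f i (arbitrary tie-breaking) *)
Variable sel : {set 'I_n} -> ('I_n -> R) -> 'I_n.

Definition up_round (t : 'I_n -> nat -> R) (m : nat) (st : up_state) : up_state :=
  let I := cand st in
  let k := kexp st in
  let lcb := fun i => LCB t i m (k i) in
  let istar := sel I lcb in
  let I' := [set i in I | ~~ (UCB t i m (k i) < lcb istar)] in
  let k' := fun i => if (i \in I) &&
                         (2 * alpha m (k i) <= u (captime (k i)) * (1 - Fhat t i m (k i)))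
                     then (k i).+1 else k i in
  UPState I' k' (Some istar) (#|I'| == 1%N).

(* s i m j : uncapped runtime of algorithm i on instance j of round m *)
Fixpoint up_run (s : 'I_n -> nat -> nat -> R) (m : nat) : up_state :=
  match m with
  | 0 => up_init
  | m'.+1 => let st := up_run s m' in
             if stopped st then st else up_round (fun i => s i m) m st
  end.

End UP.

(* Main.v *)
Require Import Defs.
From HB Require Import structures.
From mathcomp Require Import all_boot all_order all_algebra.
From mathcomp Require Import all_classical all_reals all_analysis.
From mathcomp Require Import measurable_realfun ring lra.
Import Order.TTheory GRing.Theory Num.Theory.
Import numFieldNormedType.Exports.
Local Open Scope classical_set_scope.
Local Open Scope ring_scope.

(** For fixed algorithm, round and captime exponent, the round's runtimes are
    i.i.d., so Hoeffding's inequality bounds by [2 exp (-2 m alpha^2)] the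
    probability that the empirical capped utility, rescaled by its range
    [1 - u kappa], is [alpha] away from its mean, and likewise for the empirical
    CDF.  A union bound over algorithms, rounds and all exponents costs at most
    [4 (sum_m 1/m^2)^2 delta / 11 <= delta]; no adaptivity issue arises since
    captimes only take the values [2^k].  Off this event
    [LCB <= U <= UCB], both within [2 alpha + u kappa (1 - F kappa)] of [U], so
    the optimum is never eliminated, and the claims follow by comparing bounds.
    For termination, [alpha -> 0], and as long as [u kappa (1 - F kappa)]
    exceeds [3 alpha] the captime doubles, so all confidence widths tend to
    0. *)

(** * Hoeffding's lemma for Bernoulli variables *)

Section bernoulli_mgf.
Context {R : realType}.

(** A nonnegative derivative makes [f] nondecreasing on the half-line from [f 0 = 0]. Used twice in
    a row, this passes from a second derivative to the function. *)
Lemma ge0_derive_ge0 (f f' : R -> R) :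
  (forall x : R, is_derive x 1 f (f' x)) -> f 0 = 0 ->
  (forall x, 0 <= x -> 0 <= f' x) -> forall x, 0 <= x -> 0 <= f x.
Proof.
move=> df f00 f'0 x x0; rewrite -f00.
apply: (@ger0_derive1_ndecry _ f 0) => // [y|].
- rewrite in_itv/= andbT => /ltW /f'0; rewrite derive1E.
  by have [_ ->] := df y.
- apply: derivable_within_continuous => y _.
  by have [] := df y.
Qed.

(* Hoeffding's lemma for a Bernoulli variable of mean [p]: the second
   derivative of the log of the left-hand side is [q (1 - q) <= 1/4], with [q]
   the mean under the exponentially tilted law. *)
Lemma bernoulli_mgf_le (p s : R) : 0 <= p <= 1 -> 0 <= s ->
  1 - p + p * expR s <= expR (s * p + s ^+ 2 / 8).
Proof.
move=> /andP[p0 p1] s0.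
pose g (x : R) := 1 - p + p * expR x.
have g0 x : 0 < g x.
  rewrite /g; have [->|pn0] := eqVneq p 0; first by rewrite subr0 mul0r addr0.
  by rewrite ltr_wpDl ?subr_ge0// mulr_gt0 ?expR_gt0// lt0r pn0.
have gn0 x : g x != 0 by rewrite gt_eqF.
have dg (x : R) : is_derive x 1 g (p * expR x).
  rewrite /g; apply: is_derive_eq; rewrite /GRing.scale/=; ring.
pose q (x : R) := p * expR x / g x.
have dq (x : R) : is_derive x 1 (fun x => x / 4 + p - q x) (4^-1 - q x * (1 - q x)).
  rewrite /q; apply: is_derive_eq; rewrite /GRing.scale/=.
  by field; exact: gn0.
have dl (x : R) : is_derive x 1 (fun x => x * p + x ^+ 2 / 8 - ln (g x))
    (x / 4 + p - q x).
  have dlg := is_derive1_comp (is_derive1_ln (g0 x)) (dg x).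
  apply: is_derive_eq; rewrite /GRing.scale/=.
  by rewrite /q; field; exact: gn0.
have q0 : q 0 = p by rewrite /q /g expR0 mulr1 subrK divr1.
have : 0 <= s * p + s ^+ 2 / 8 - ln (g s).
  apply: (ge0_derive_ge0 _ _ dl) => //.
    by rewrite mul0r expr0n mul0r /g expR0 mulr1 subrK ln1 addr0 subrr.
  apply: (ge0_derive_ge0 _ _ dq) => //; first by rewrite q0 mul0r add0r subrr.
  by move=> x _; rewrite (_ : _ - _ = (2^-1 - q x) ^+ 2) ?sqr_ge0//; field.
by rewrite subr_ge0 -ler_expR lnK// posrE.
Qed.

End bernoulli_mgf.

(** * Product rule for expectations and Hoeffding's inequality for i.i.d. samples *)

Section independence.
Context {R : realType} {d : measure_display} {Omega : measurableType d}.
Variable P : probability Omega R.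

Import HBNNSimple.

(** Both sides are linear in [f] and continuous along increasing sequences, so the identity passes
    from indicators to simple functions and then, by monotone convergence, to all nonnegative
    measurable [f]. [Z] carries the remaining factors of a product. *)
Lemma ge0_integral_slot (X Z : Omega -> R) (D : probability R R) (c : R)
    (f : R -> R) :
  measurable_fun setT X -> measurable_fun setT Z -> (forall w, 0 <= Z w) ->
  0 <= c -> measurable_fun setT f -> (forall x, 0 <= f x) ->
  (forall B, measurable B ->
    (\int[P]_w (Z w * \1_B (X w))%:E = c%:E * D B)%E) ->
  (\int[P]_w (Z w * f (X w))%:E = c%:E * \int[D]_x (f x)%:E)%E.
Proof.
move=> mX mZ Z0 c0 mf f0 ZX.
have mEf : measurable_fun [set: R] (EFin \o f) by exact/measurable_EFinP.
pose h := nnsfun_approx measurableT mEf.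
have hf x : (EFin \o h n) x @[n --> \oo] --> (f x)%:E.
  by apply: cvg_nnsfun_approx => // y _ /=; rewrite lee_fin.
have hnd x : {homo (fun n => (h n x)%:E) : a b / (a <= b)%N >-> (a <= b)%E}.
  by move=> a b ab; rewrite lee_fin; exact/lefP/nd_nnsfun_approx.
have mhX n : measurable_fun setT (h n \o X) by exact: measurableT_comp.
have -> : (\int[D]_x (f x)%:E = limn (fun n => \int[D]_x (h n x)%:E))%E.
  rewrite -monotone_convergence//.
  - by apply: eq_integral => x _; apply/esym/cvg_lim => //; exact: hf.
  - by move=> n; exact/measurable_EFinP.
  - by move=> n x _; rewrite lee_fin.
have -> : (\int[P]_w (Z w * f (X w))%:E =
           limn (fun n => \int[P]_w (Z w * h n (X w))%:E))%E.
  rewrite -monotone_convergence//.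
  - apply: eq_integral => w _; apply/esym/cvg_lim => //.
    under eq_fun do rewrite EFinM.
    by rewrite EFinM; apply: cvgeZl => //; exact: hf.
  - by move=> n; apply/measurable_EFinP; exact: (measurable_funM mZ (mhX n)).
  - by move=> n w _; rewrite lee_fin mulr_ge0.
  - move=> w _ a b ab; rewrite lee_fin ler_wpM2l//.
    by rewrite -lee_fin; exact: hnd.
rewrite -limeMl//; last first.
  apply: ereal_nondecreasing_is_cvgn => a b ab; apply: ge0_le_integral => //.
  - by move=> x _; rewrite lee_fin.
  - by apply/measurable_EFinP.
  - by apply/measurable_EFinP.
  - by move=> x _; exact: hnd.
congr (limn _); apply/funext => n.
rewrite integralT_nnsfun sintegralE.
under eq_integral.
  move=> w _; rewrite fimfunE EFinM -fsumEFin// ge0_mule_fsumr; last first.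
    by move=> y; rewrite nnfun_muleindic_ge0.
  over.
have mXy y : measurable (h n @^-1` [set y]) by [].
rewrite ge0_integral_fsum//; first last.
- move=> y w _; rewrite mule_ge0 ?lee_fin ?nnfun_muleindic_ge0//.
  by have := nnfun_muleindic_ge0 (h n) y (X w); rewrite lee_fin.
- move=> y; apply/measurable_EFinP; apply: measurable_funM => //.
  apply: measurable_funM => //; exact: measurableT_comp.
rewrite ge0_mule_fsumr; last first.
  by move=> y; exact: nnsfun_mulemu_ge0.
apply: eq_fsbigr => y; rewrite inE => -[x _ hxy].
have y0 : 0 <= y by rewrite -hxy.
transitivity (\int[P]_w (y%:E * (Z w * \1_(h n @^-1` [set y]) (X w))%:E))%E.
  by apply: eq_integral => w _; rewrite -!EFinM mulrCA.
rewrite ge0_integralZl//; first by rewrite ZX// muleCA.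
- apply/measurable_EFinP; apply: measurable_funM => //.
  exact: measurableT_comp.
- by move=> w _; rewrite lee_fin mulr_ge0.
Qed.
Context {I : eqType} (T : I -> Omega -> R) (D : probability R R).
Hypothesis mT : forall p, measurable_fun setT (T p).
Hypothesis indT : forall (s : seq I) (B : I -> set R),
  uniq s -> (forall p, measurable (B p)) ->
  P (\big[setI/setT]_(p <- s) (T p @^-1` B p)) = (\prod_(p <- s) D (B p))%E.

(* The factors are switched one at a time from indicators, for which the
   product rule is the hypothesis, to [f]. *)
Let ge0_integral_prod_indic (f : R -> R) (c : R) (s1 s2 : seq I)
    (B : I -> set R) :
  measurable_fun setT f -> (forall x, 0 <= f x) ->
  (\int[D]_x (f x)%:E = c%:E)%E -> uniq (s1 ++ s2) ->
  (forall p, measurable (B p)) ->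
  (\int[P]_w ((\prod_(p <- s1) f (T p w)) *
              \prod_(p <- s2) \1_(B p) (T p w))%:E =
   (c ^+ size s1 * \prod_(p <- s2) fine (D (B p)))%:E)%E.
Proof.
move=> mf f0 fc.
have c0 : 0 <= c.
  by rewrite -lee_fin -fc; apply: integral_ge0 => x _; rewrite lee_fin.
have fineD A : measurable A -> D A = (fine (D A))%:E.
  by move=> mA; rewrite fineK// fin_num_measure.
elim: s1 s2 B => [|p s1 IH] s2 B us mB.
  have -> : (1 ^+ 0 * \prod_(p <- s2) fine (D (B p)))%:E =
            (\prod_(p <- s2) D (B p))%E.
    rewrite expr0 mul1r; elim: (s2) => [|q s IHs]; first by rewrite !big_nil.
    by rewrite !big_cons EFinM IHs -fineD.
  rewrite -indT//.
  have mcap : measurable (\big[setI/setT]_(p <- s2) (T p @^-1` B p)).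
    apply: bigsetI_measurable => q _; rewrite -[_ @^-1` _]setTI.
    exact: mT.
  rewrite -[X in P X]setIT -integral_indic//.
  apply: eq_integral => w _; rewrite big_nil mul1r; congr EFin.
  elim: (s2) => [|q s IHs]; first by rewrite !big_nil indicT.
  by rewrite !big_cons indicI /= IHs !indicE.
have mZ : measurable_fun setT (fun w =>
    (\prod_(q <- s1) f (T q w)) * \prod_(q <- s2) \1_(B q) (T q w)).
  apply: measurable_funM.
    by apply: (@measurable_prod _ _ _ _ _ _ (fun q w => f (T q w))) => q _;
      exact: measurableT_comp.
  apply: (@measurable_prod _ _ _ _ _ _ (fun q w => \1_(B q) (T q w))) => q _.
  by apply: measurableT_comp => //; exact: measurable_indic.
under eq_integral do rewrite big_cons -mulrA mulrC.
rewrite (@ge0_integral_slot (T p) _ D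
    (c ^+ size s1 * \prod_(q <- s2) fine (D (B q))) f)//.
- by rewrite fc -EFinM /= exprSr mulrAC.
- by move=> w; rewrite mulr_ge0 ?prodr_ge0.
- by rewrite mulr_ge0 ?exprn_ge0// prodr_ge0// => q _; rewrite fine_ge0.
(* With an arbitrary indicator in slot [p], the induction hypothesis applies with [p] moved into
   [s2]; uniqueness of the list ensures that overriding [B] at [p] leaves the other factors of [s2]
   alone. *)
- move=> B' mB'; pose Bp q := if q == p then B' else B q.
  have mBp q : measurable (Bp q) by rewrite /Bp; case: ifP.
  have ps2 q : q \in s2 -> Bp q = B q.
    rewrite /Bp; case: eqP => // -> ps2.
    by move: us; rewrite cat_uniq => /and3P[_ /hasPn/(_ p ps2)]; rewrite inE eqxx.
  have BpE : \prod_(q <- s2) fine (D (Bp q)) = \prod_(q <- s2) fine (D (B q)).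
    by apply: eq_big_seq => q /ps2 ->.
  have us' : uniq (s1 ++ p :: s2) by rewrite (uniq_catCA s1 [:: p] s2).
  have Bpp : Bp p = B' by rewrite /Bp eqxx.
  have := IH (p :: s2) Bp us' mBp; rewrite big_cons BpE Bpp => IHp.
  rewrite (fineD B')// -EFinM -mulrA [_ * fine _]mulrC -IHp.
  apply: eq_integral => w _; rewrite big_cons Bpp -!mulrA; congr EFin.
  congr (_ * _); rewrite mulrC; congr (_ * _).
  by apply: eq_big_seq => q /ps2 ->.
Qed.

Lemma integral_prod_indep (f : R -> R) (c : R) (s : seq I) :
  measurable_fun setT f -> (forall x, 0 <= f x) ->
  (\int[D]_x (f x)%:E = c%:E)%E -> uniq s ->
  (\int[P]_w (\prod_(p <- s) f (T p w))%:E = (c ^+ size s)%:E)%E.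
Proof.
move=> mf f0 fc us.
have := @ge0_integral_prod_indic f c s [::] (fun=> setT) mf f0 fc.
rewrite cats0 big_nil mulr1 => <- //.
by apply: eq_integral => w _; rewrite big_nil mulr1.
Qed.
(** By convexity. After integration the right-hand side is the moment generating function of a
    Bernoulli variable with the same mean, so the Bernoulli case covers every variable with values
    in [[0, 1]]. *)
Lemma expR_le_chord (l x : R) : 0 <= x <= 1 ->
  expR (l * x) <= 1 - x + x * expR l.
Proof.
move=> /andP[x0 x1].
have xi : Itv.spec (@Itv.num_sem R) (Itv.Real `[0%Z, 1%Z]) x.
  by apply/and3P; split; rewrite ?ger0_real// in_itv/= ?x0 ?x1.
have := convex_expR (Itv.mk xi) l 0.
rewrite !convRE/= expR0 /unstable.onem mulr0 addr0 mulr1 [x * l]mulrC; lra.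
Qed.

Lemma integral_onem (f : R -> R) (c : R) :
  measurable_fun setT f -> (forall x, 0 <= f x <= 1) ->
  (\int[D]_x (f x)%:E = c%:E)%E -> (\int[D]_x (1 - f x)%:E = (1 - c)%:E)%E.
Proof.
move=> mf f01 fc.
have f0 x : 0 <= f x by have /andP[] := f01 x.
have f1 x : f x <= 1 by have /andP[] := f01 x.
have : (\int[D]_x ((1 - f x)%:E + (f x)%:E) = 1)%E.
  under eq_integral do rewrite -EFinD subrK.
  by rewrite integral_cst// mul1e; exact: probability_setT.
rewrite ge0_integralD//; last 4 first.
- by move=> x _; rewrite lee_fin subr_ge0.
- by apply/measurable_EFinP; exact: measurable_funB.
- by move=> x _; rewrite lee_fin.
- exact/measurable_EFinP.
rewrite fc; have : (0 <= \int[D]_x (1 - f x)%:E)%E.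
  by apply: integral_ge0 => x _; rewrite lee_fin subr_ge0.
by case: (integral _ _ _) => // r _ [<-]; rewrite addrK.
Qed.

Lemma measurable_sum_comp (h : R -> R) (s : seq I) : measurable_fun setT h ->
  measurable_fun setT (fun w => \sum_(p <- s) h (T p w)).
Proof.
move=> mh; apply: (@measurable_sum _ _ _ _ _ _ (fun p w => h (T p w))) => p.
exact: (measurableT_comp mh).
Qed.

Lemma measurable_superlevel (X : Omega -> R) (y : R) :
  measurable_fun setT X -> measurable [set w | y <= X w].
Proof.
move=> mX; rewrite (_ : [set _ | _] = setT `&` X @^-1` `[y, +oo[%classic).
  exact: mX.
by apply/seteqP; split => w; rewrite /= in_itv/= andbT; [|case].
Qed.

(** Chernoff's method: bound the indicator of the event by [expR (l * (sum - (c + e) * m))], factor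
    the expectation by independence, and bound each factor by the chord and the Bernoulli
    estimate. *)
Lemma hoeffding_indep (f : R -> R) (c e : R) (s : seq I) :
  measurable_fun setT f -> (forall x, 0 <= f x <= 1) ->
  (\int[D]_x (f x)%:E = c%:E)%E -> uniq s -> 0 <= e ->
  (P [set w | ((c + e) *+ size s <= \sum_(p <- s) f (T p w))%R] <=
   (expR (- (2 * (size s)%:R * e ^+ 2)))%:E)%E.
Proof.
move=> mf f01 fc us e0.
(* The value [4 * e] minimizes the exponent [l ^+ 2 / 8 - l * e] per sample, giving
   [- 2 * e ^+ 2]. *)
set m := size s; set l := 4 * e.
have l0 : 0 <= l by rewrite mulr_ge0.
have f0 x : 0 <= f x by have /andP[] := f01 x.
have f1 x : f x <= 1 by have /andP[] := f01 x.
have c01 : 0 <= c <= 1.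
  rewrite -!lee_fin -fc integral_ge0/=; last by move=> x _; rewrite lee_fin.
  apply: (@le_trans _ _ (\int[D]_x (cst 1%E x))%E).
    apply: ge0_le_integral => //.
    - by move=> x _; rewrite lee_fin.
    - exact/measurable_EFinP.
    - by move=> x _; rewrite lee_fin.
  by rewrite integral_cst// mul1e [leLHS]probability_setT.
have mg : measurable_fun setT (fun x => expR (l * f x)).
  by apply: measurableT_comp => //; exact: measurable_funM.
have [M gM M_le] : exists2 M,
    (\int[D]_x (expR (l * f x))%:E = M%:E)%E & M <= expR (l * c + l ^+ 2 / 8).
  have chord : (\int[D]_x (expR (l * f x))%:E <= (1 - c + c * expR l)%:E)%E.
    apply: (@le_trans _ _
        (\int[D]_x ((1 - f x)%:E + (expR l)%:E * (f x)%:E))%E).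
      apply: ge0_le_integral => //.
      - exact/measurable_EFinP.
      - apply/measurable_EFinP; apply: measurable_funD.
          exact: measurable_funB.
        exact: measurable_funM.
      - move=> x _; rewrite -EFinM -EFinD lee_fin [expR l * _]mulrC.
        exact: expR_le_chord.
    rewrite ge0_integralD//=; last 4 first.
    - by move=> x _; rewrite lee_fin subr_ge0.
    - by apply/measurable_EFinP; exact: measurable_funB.
    - by move=> x _; rewrite -EFinM lee_fin mulr_ge0// expR_ge0.
    - by apply: emeasurable_funM => //; exact/measurable_EFinP.
    rewrite ge0_integralZl//; last 2 first.
    - exact/measurable_EFinP.
    - by move=> x _; rewrite lee_fin.
    rewrite (integral_onem _ _ mf f01 fc) fc -EFinM -EFinD lee_fin.
    by rewrite [expR l * _]mulrC.
  exists (fine (\int[D]_x (expR (l * f x))%:E)).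
    rewrite fineK// ge0_fin_numE ?(le_lt_trans chord) ?ltry//.
    by apply: integral_ge0 => x _; rewrite lee_fin expR_ge0.
  rewrite -lee_fin fineK; last first.
    rewrite ge0_fin_numE ?(le_lt_trans chord) ?ltry//.
    by apply: integral_ge0 => x _; rewrite lee_fin expR_ge0.
  by rewrite (le_trans chord)// lee_fin bernoulli_mgf_le.
have M0 : 0 <= M.
  rewrite -lee_fin -gM; apply: integral_ge0 => x _.
  by rewrite lee_fin expR_ge0.
set A := [set w | _].
have mA : measurable A.
  by apply: measurable_superlevel; exact: measurable_sum_comp.
have mprod : measurable_fun setT (fun w => \prod_(p <- s) expR (l * f (T p w))).
  apply: (@measurable_prod _ _ _ _ _ _
    (fun p w => expR (l * f (T p w)))) => p _.
  exact: (measurableT_comp mg).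
rewrite -[A]setIT -integral_indic//.
apply: (@le_trans _ _ (\int[P]_w
    ((expR (- (l * ((c + e) *+ m))))%:E * (\prod_(p <- s) expR (l * f (T p w)))%:E))%E).
  apply: ge0_le_integral => //.
  - by apply/measurable_EFinP; exact: measurable_indic.
  - by apply: emeasurable_funM => //; exact/measurable_EFinP.
  - move=> w _; rewrite -EFinM lee_fin -expR_sum -mulr_sumr -expRD indicE.
    case: (boolP (w \in A)) => [|_]; last by rewrite expR_ge0.
    rewrite inE /A /= => wA; rewrite -[1]expR0 ler_expR.
    by rewrite -mulrN -mulrDr mulr_ge0// addrC subr_ge0.
rewrite ge0_integralZl//; last 2 first.
- exact/measurable_EFinP.
- by move=> w _; rewrite lee_fin prodr_ge0// => p _; rewrite expR_ge0.
rewrite (integral_prod_indep _ _ _ mg _ gM us); last by move=> x; rewrite expR_ge0.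
rewrite -EFinM lee_fin.
apply: (@le_trans _ _ (expR (- (l * ((c + e) *+ m))) * expR (l * c + l ^+ 2 / 8) ^+ m)).
  by rewrite ler_wpM2l ?expR_ge0// lerXn2r// nnegrE ?expR_ge0.
rewrite -expRM_natl -expRD ler_expR /l -mulr_natl.
by rewrite le_eqVlt; apply/orP; left; apply/eqP; field.
Qed.
(** The affine rescaling [g] of [f] to [[0, 1]] reduces this to the one-sided bound, applied to [g]
    and to [1 - g]. Deviations are measured in units of the range [b - a], which is what puts the
    factor [1 - u kappa] into [UCB]. *)
Lemma hoeffding_indep_abs (f : R -> R) (a b c e : R) (s : seq I) :
  measurable_fun setT f -> 0 <= a -> a < b -> (forall x, a <= f x <= b) ->
  (\int[D]_x (f x)%:E = c%:E)%E -> uniq s -> 0 <= e ->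
  (P [set w | (((b - a) * e) *+ size s <=
               `|\sum_(p <- s) f (T p w) - c *+ size s|)%R] <=
   (2 * expR (- (2 * (size s)%:R * e ^+ 2)))%:E)%E.
Proof.
move=> mf a0 ab fab fc us e0; have ba0 : 0 < b - a by rewrite subr_gt0.
have ban0 : b - a != 0 by rewrite gt_eqF.
pose g x := (f x - a) / (b - a).
have mg : measurable_fun setT g by apply: measurable_funM => //; exact: measurable_funB.
have g01 x : 0 <= g x <= 1.
  have /andP[fa fb] := fab x.
  rewrite /g ler_pdivrMr// mul1r lerD2r fb andbT.
  by rewrite divr_ge0 ?subr_ge0// ltW.
have gc : (\int[D]_x (g x)%:E = ((c - a) / (b - a))%:E)%E.
  have : (\int[D]_x (a%:E + (b - a)%:E * (g x)%:E) = c%:E)%E.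
    rewrite -fc; apply: eq_integral => x _; rewrite -EFinM -EFinD; congr EFin.
    by rewrite /g mulrC divfK// addrC subrK.
  have g0 x : 0 <= g x by have /andP[] := g01 x.
  rewrite ge0_integralD//; last 2 first.
  - by move=> x _; rewrite -EFinM lee_fin mulr_ge0// ltW.
  - by apply: emeasurable_funM => //; exact/measurable_EFinP.
  rewrite ge0_integralZl//; last 3 first.
  - exact/measurable_EFinP.
  - by move=> x _; rewrite lee_fin.
  - by rewrite lee_fin ltW.
  rewrite (_ : (\int[D]_x a%:E)%E = a%:E); last first.
    rewrite [LHS](integral_cst D measurableT a%:E).
    by rewrite -[RHS]mule1; congr (_ * _)%E; exact: probability_setT.
  have : (0 <= \int[D]_x (g x)%:E)%E.
    by apply: integral_ge0 => x _; rewrite lee_fin.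
  case: (integral _ _ _) => [r _ /= [<-]|_|//].
    by rewrite addrAC subrr add0r mulrC mulKf.
  by rewrite gt0_muley ?lte_fin.
have g'01 x : 0 <= 1 - g x <= 1.
  by have /andP[? ?] := g01 x; apply/andP; split; lra.
have gc' := integral_onem _ _ mg g01 gc.
have mg' : measurable_fun setT (fun x => 1 - g x) by exact: measurable_funB.
have up := hoeffding_indep _ _ _ _ mg g01 gc us e0.
have dn := hoeffding_indep _ _ _ _ mg' g'01 gc' us e0.
have sumg w : \sum_(p <- s) g (T p w) =
    (\sum_(p <- s) f (T p w) - a *+ size s) / (b - a).
  by rewrite -mulr_suml big_split/= sumrN big_const_seq count_predT iter_addr addr0.
have sumg' w : \sum_(p <- s) (1 - g (T p w)) = (size s)%:R - \sum_(p <- s) g (T p w).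
  by rewrite big_split/= sumrN big_const_seq count_predT iter_addr addr0.
have mS (h : R -> R) : measurable_fun setT h ->
    forall y, measurable [set w | y <= \sum_(p <- s) h (T p w)].
  by move=> mh y; apply: measurable_superlevel; exact: measurable_sum_comp.
rewrite (_ : [set _ | _] =
    [set w | ((c - a) / (b - a) + e) *+ size s <= \sum_(p <- s) g (T p w)] `|`
    [set w | (1 - (c - a) / (b - a) + e) *+ size s <=
             \sum_(p <- s) (1 - g (T p w))]).
  rewrite (le_trans (measureU2 _ _ _))//; [exact: (mS _ mg)|exact: (mS _ mg')|].
  by rewrite mulr_natl mulr2n EFinD leeD.
have gE (S : R) (n : nat) :
    (((c - a) / (b - a) + e) *+ n <= (S - a *+ n) / (b - a)) =
    (((b - a) * e) *+ n <= S - c *+ n).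
  rewrite -(mulr_natr (_ + e)) -(mulr_natr a) -(mulr_natr (_ * e)) -(mulr_natr c).
  by rewrite ler_pdivlMr// -subr_ge0 -[RHS]subr_ge0; congr (0 <= _); field.
have gE' (S : R) (n : nat) :
    ((1 - (c - a) / (b - a) + e) *+ n <= n%:R - (S - a *+ n) / (b - a)) =
    (((b - a) * e) *+ n <= - (S - c *+ n)).
  rewrite -(mulr_natr (_ + e)) -(mulr_natr a) -(mulr_natr (_ * e)) -(mulr_natr c).
  rewrite -subr_ge0 -[RHS]subr_ge0 -(pmulr_rge0 _ ba0).
  by congr (0 <= _); field.
apply/seteqP; split => w /=; rewrite sumg' sumg gE gE' ler_normr.
  by move/orP.
by move=> ?; apply/orP.
Qed.

End independence.

(** * Series of inverse squares, with [33 / 20] as a rational bound for [pi ^ 2 / 6] *)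

Lemma sum_inv_sqr_le {R : realFieldType} (N : nat) :
  \sum_(k < N) (k.+1%:R ^+ 2)^-1 <= (33 / 20 : R).
Proof.
(* [1/k^2 <= 1/(k - 1/2) - 1/(k + 1/2)], applied from [k = 3] on *)
have tail n : \sum_(k < n.+2) (k.+1%:R ^+ 2)^-1 <=
    (33 / 20 - (n%:R + 5 / 2)^-1 : R).
  elim: n => [|n IH].
    rewrite !big_ord_recr big_ord0/= le_eqVlt; apply/orP; left; apply/eqP.
    by field.
  rewrite big_ord_recr/= (le_trans (lerD IH (lexx _)))//.
  rewrite -addrA lerD2l -[n.+3]addn3 -[n.+1]addn1 !natrD.
  have : 0 <= n%:R :> R by []; move: (n%:R : R) => x x0.
  rewrite -subr_ge0.
  rewrite [X in 0 <= X](_ : _ = (4 * (x + 5 / 2) * (x + 3) ^+ 2 * (x + 7 / 2))^-1).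
    by rewrite invr_ge0 !mulr_ge0 ?sqr_ge0//; lra.
  field.
  by rewrite ?gt_eqF//=; lra.
case: N => [|[|n]].
- by rewrite big_ord0; lra.
- by rewrite big_ord_recr big_ord0/=; lra.
- by rewrite (le_trans (tail n))// gerBl invr_ge0 addr_ge0.
Qed.

(** Serves twice in the union bound, for the sum over captime exponents and for the sum over rounds,
    at a factor [33 / 20] each time. *)
Lemma nneseries_inv_sqr_le {R : realType} (a : nat -> \bar R) (C : R) :
  0 <= C -> (forall k, 0 <= a k)%E ->
  (forall k, a k <= (C / k.+1%:R ^+ 2)%:E)%E ->
  (\sum_(k <oo) a k <= (33 / 20 * C)%:E)%E.
Proof.
move=> C0 a0 aC; apply: lime_le; first exact: is_cvg_nneseries.
near=> n; rewrite big_mkord.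
apply: (@le_trans _ _ (\sum_(k < n) (C / k.+1%:R ^+ 2)%:E)%E).
  by apply: lee_sum => k _.
by rewrite sumEFin lee_fin -mulr_sumr mulrC ler_wpM2r// sum_inv_sqr_le.
Unshelve. all: by end_near. Qed.

(** * The confidence radius [alpha] *)

Section alpha.
Context {R : realType} (n : nat) (delta : R).
Hypothesis n0 : (0 < n)%N.
Hypothesis delta01 : 0 < delta < 1.

Let delta0 : 0 < delta. Proof. by case/andP: delta01. Qed.

Let C : R := 11 * n%:R / delta.

Let C1 : 1 < C.
Proof.
rewrite /C ltr_pdivlMr// mul1r; case/andP: delta01 => _ d1.
have : 1 <= n%:R :> R by rewrite ler1n.
lra.
Qed.

Let alphaE m k : alpha n delta m.+1 k =
  Num.sqrt (ln (C * (m.+1%:R * k.+1%:R) ^+ 2) / (2 * m.+1%:R)).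
Proof.
rewrite /alpha -(natr1 k) /C; congr (Num.sqrt (ln _ / _)).
by field; rewrite gt_eqF.
Qed.

Let arg_gt1 m k : 1 < C * (m.+1%:R * k.+1%:R) ^+ 2.
Proof.
by rewrite (lt_le_trans C1)// ler_peMr ?(ltW (lt_trans ltr01 C1))// -natrM
  exprn_ege1// ler1n muln_gt0.
Qed.

Lemma alpha_gt0 m k : 0 < alpha n delta m.+1 k.
Proof. by rewrite alphaE sqrtr_gt0 divr_gt0// ln_gt0. Qed.

(** The radius is the solution of this equation: Hoeffding's tail becomes summable over both rounds
    and captime exponents. *)
Lemma expR_alpha m k : expR (- (2 * m.+1%:R * alpha n delta m.+1 k ^+ 2)) =
  delta / (11 * n%:R) / m.+1%:R ^+ 2 / k.+1%:R ^+ 2.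
Proof.
have A1 := arg_gt1 m k; have A0 := lt_trans ltr01 A1.
rewrite alphaE sqr_sqrtr ?divr_ge0 ?ln_ge0 ?ltW// mulrC divfK ?gt_eqF//.
rewrite expRN lnK ?posrE// /C; field.
by rewrite ?pnatr_eq0 -?lt0n ?n0 ?gt_eqF//= !nat1r !pnatr_eq0.
Qed.

(** The logarithm grows more slowly than [m], even when the exponent [k] grows with the round;
    uniformity over [k <= m] is needed because captimes keep doubling during a run. *)
Lemma alpha_cvg0 (e : R) : 0 < e ->
  exists M, forall m k, (M <= m)%N -> (k <= m)%N -> alpha n delta m.+1 k <= e.
Proof.
move=> e0; have C0 := lt_trans ltr01 C1.
have lnC0 : 0 <= ln C by rewrite ln_ge0// ltW.
(* With [x] the square root of [m.+1], the logarithm is at most [ln C + 8 * ln x <= (ln C + 8) * x],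
   and this is at most [2 * e ^+ 2 * x ^+ 2] as soon as [S <= x]. *)
pose S := (ln C + 8) / (2 * e ^+ 2).
have S0 : 0 <= S by rewrite divr_ge0 ?mulr_ge0 ?addr_ge0 ?exprn_ge0 ?(ltW e0).
exists (Num.bound (S ^+ 2)) => m k Mm km.
have Sm : S ^+ 2 <= m.+1%:R.
  rewrite ltW// (lt_le_trans (archi_boundP _)) ?sqr_ge0// ler_nat.
  exact: leqW.
pose x : R := Num.sqrt m.+1%:R.
have xx : x ^+ 2 = m.+1%:R by rewrite sqr_sqrtr.
have x1 : 1 <= x by rewrite -sqrtr1 ler_wsqrtr// ler1n.
have Sx : S <= x by rewrite -(ler_sqr S0) ?nnegrE ?sqrtr_ge0// xx.
have lnx : ln x <= x.
  by rewrite ltW// ln_sublinear// (lt_le_trans ltr01).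
rewrite alphaE -[e]ger0_norm ?(ltW e0)// -sqrtr_sqr ler_wsqrtr//.
rewrite ler_pdivrMr//.
have x0 : 0 < x by exact: lt_le_trans x1.
have mkx : m.+1%:R * k.+1%:R <= x ^+ 4.
  by rewrite (exprM x 2 2) xx expr2 ler_wpM2l// ler_nat.
apply: (@le_trans _ _ (ln (C * x ^+ 8))).
  have A0 := lt_trans ltr01 (arg_gt1 m k).
  have B0 : 0 < C * x ^+ 8 by rewrite mulr_gt0// exprn_gt0.
  rewrite ler_ln ?posrE// ler_wpM2l ?(ltW C0)//.
  by rewrite (exprM x 4 2) lerXn2r// nnegrE ?mulr_ge0 ?exprn_ge0 ?(ltW x0).
rewrite lnM ?posrE ?exprn_gt0// lnXn// -xx.
have : (ln C + 8) * x <= (2 * e ^+ 2) * x ^+ 2.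
  rewrite [x ^+ 2]expr2 mulrA ler_wpM2r ?(ltW x0)//.
  by rewrite mulrC -ler_pdivrMr ?mulr_gt0 ?exprn_gt0.
have : ln C <= ln C * x by rewrite ler_peMr.
rewrite -mulr_natl; lra.
Qed.

End alpha.

(** * Deterministic analysis of a run on which all confidence bounds hold *)

Section good_event.
Context {R : realType} {n : nat} (u : R -> R) (delta : R).
Context (sel : {set 'I_n} -> ('I_n -> R) -> 'I_n) (iopt : 'I_n).
Context (s : 'I_n -> nat -> nat -> R) (U : 'I_n -> R) (G : 'I_n -> nat -> R).

Let t m i := s i m.
Let al m k : R := alpha n delta m k.
(** The state [st m] is the one before round [m.+1]: that round draws the samples [t m.+1] with the
    captimes recorded in [st m]. *)
Let st := up_run u delta sel s.
Let lcb m i := LCB u delta (t m.+1) i m.+1 (kexp (st m) i).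
Let istar m := sel (cand (st m)) (lcb m).
Let W m i := 2 * al m.+1 (kexp (st m) i) + G i (kexp (st m) i).

Hypothesis n0 : (0 < n)%N.
Hypothesis delta01 : 0 < delta < 1.
Hypothesis selP : forall (I : {set 'I_n}) (f : 'I_n -> R), (0 < #|I|)%N ->
  sel I f \in I /\ forall j, j \in I -> f j <= f (sel I f).
Hypothesis U_max : forall j, U j <= U iopt.
(** The bounds are assumed for every exponent [k], so they apply to whatever captimes the run
    reaches. [G i k] stands for [u kappa (1 - F kappa)] at [kappa = 2 ^ k]. *)
Hypothesis LCB_le : forall i m k, LCB u delta (t m.+1) i m.+1 k <= U i.
Hypothesis UCB_ge : forall i m k, U i <= UCB u delta (t m.+1) i m.+1 k.
Hypothesis UCB_lt : forall i m k,
  UCB u delta (t m.+1) i m.+1 k < U i + (2 * al m.+1 k + G i k).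
Hypothesis LCB_gt : forall i m k,
  U i - (2 * al m.+1 k + G i k) < LCB u delta (t m.+1) i m.+1 k.
Hypothesis no_doubling : forall i m k,
  ~~ (2 * al m.+1 k <= u (captime R k) * (1 - Fhat (t m.+1) i m.+1 k)) ->
  G i k <= 3 * al m.+1 k.
Hypothesis G_nincr : forall i k, G i k.+1 <= G i k.
Hypothesis G_small : forall i (e : R), 0 < e -> exists K, G i K <= e.

Let stS m : ~~ stopped (st m) -> st m.+1 = up_round u delta sel (t m.+1) m.+1 (st m).
Proof. by rewrite /st /= => /negbTE ->. Qed.

Let stS_stopped m : stopped (st m) -> st m.+1 = st m.
Proof. by rewrite /st /= => ->. Qed.

(** The leading lower bound is at most the utility of the leader, hence at most [U iopt], hence at
    most the [UCB] of [iopt]. *)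
Let opt_cand m : iopt \in cand (st m).
Proof.
elim: m => [|m IH]; first by rewrite inE.
have [sm|sm] := boolP (stopped (st m)); first by rewrite stS_stopped.
rewrite (stS _ sm) inE IH -leNgt /=.
exact: (le_trans (LCB_le _ _ _) (le_trans (U_max _) (UCB_ge _ _ _))).
Qed.

Let istarP m : istar m \in cand (st m) /\
  forall j, j \in cand (st m) -> lcb m j <= lcb m (istar m).
Proof. by apply: selP; apply/card_gt0P; exists iopt. Qed.

Let ret_istar m : ~~ stopped (st m) -> ret (st m.+1) = Some (istar m).
Proof. by move=> sm; rewrite (stS _ sm). Qed.

Let istar_cand m : ~~ stopped (st m) -> istar m \in cand (st m.+1).
Proof.
move=> sm; rewrite (stS _ sm) inE (istarP m).1 -leNgt /=.
exact: (le_trans (LCB_le _ _ _) (UCB_ge _ _ _)).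
Qed.

Let cand_decr m i : i \in cand (st m.+1) -> i \in cand (st m).
Proof.
have [sm|sm] := boolP (stopped (st m)); first by rewrite stS_stopped.
by rewrite (stS _ sm) inE => /andP[].
Qed.

(** The leader's utility is at least its [LCB], which is at least the [LCB] of the surviving [iopt],
    which exceeds [U iopt - W m iopt]. *)
Lemma ret_eps_optimal m (eps : R) : ~~ stopped (st m) -> W m iopt <= eps ->
  exists j, ret (st m.+1) = Some j /\ U iopt - eps <= U j.
Proof.
move=> sm We; exists (istar m); split; first exact: ret_istar.
have h1 := LCB_gt iopt m (kexp (st m) iopt).
have h2 := (istarP m).2 _ (opt_cand m).
have h3 := LCB_le (istar m) m (kexp (st m) (istar m)).
move: h1 h2 h3 We; rewrite /lcb /W; lra.
Qed.

(** The chain is [UCB i < U i + W i <= U iopt - W iopt < LCB iopt <= LCB istar]; the strict links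
    allow equality in the hypothesis. *)
Lemma eliminated m i : ~~ stopped (st m) ->
  W m i + W m iopt <= U iopt - U i -> i \notin cand (st m.+1).
Proof.
move=> sm Wi; rewrite (stS _ sm) inE negb_and orbC negbK; apply/orP; left.
have h1 := LCB_gt iopt m (kexp (st m) iopt).
have h2 := (istarP m).2 _ (opt_cand m).
have h3 := UCB_lt i m (kexp (st m) i).
move: h1 h2 h3 Wi; rewrite /lcb /W /istar /lcb; lra.
Qed.

(** At most one doubling occurs per round, which keeps exponents in the range where [alpha] is
    uniformly small. *)
Let kexp_le m i : (kexp (st m) i <= m)%N.
Proof.
elim: m => // m IH.
have [sm|sm] := boolP (stopped (st m)); first by rewrite stS_stopped// leqW.
by rewrite (stS _ sm) /=; case: ifP => // _; exact: leqW.
Qed.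

Let G_nincr_le i k l : (k <= l)%N -> G i l <= G i k.
Proof.
move=> /subnK <-; elim: (l - k)%N => // j IH.
by rewrite addSn (le_trans (G_nincr _ _)).
Qed.

(* As long as [G] exceeds [3 alpha] the captime doubles in every round, so
   after finitely many rounds [G] is small. *)
Let W_small i (e : R) : 0 < e -> exists M, forall m, (M <= m)%N ->
  ~~ stopped (st m) -> i \in cand (st m) -> W m i <= e.
Proof.
move=> e0; have e20 : 0 < e / 2 by rewrite divr_gt0.
have [K GK] := G_small i _ e20.
(* With [alpha <= e / 6], a round without doubling gives [G <= 3 alpha <= e / 2], and the final
   width is at most [e / 3 + e / 2]. *)
have e60 : 0 < e / 6 by rewrite divr_gt0.
have [M alM] := alpha_cvg0 n delta n0 delta01 _ e60.
have step j : ~~ stopped (st (M + j)) -> i \in cand (st (M + j)) ->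
    G i (kexp (st (M + j)) i) <= e / 2 \/ (j <= kexp (st (M + j)) i)%N.
  elim: j => [|j IH]; first by right.
  rewrite addnS; have [sm|sm] := boolP (stopped (st (M + j))).
    by rewrite stS_stopped// sm.
  move=> _ /cand_decr ic; have := IH sm ic.
  rewrite (stS _ sm) /= ic /=; case: ifPn => [_|/no_doubling Gal].
    move=> [Ge|jk]; [left|by right].
    exact: le_trans (G_nincr _ _) Ge.
  move=> _; left.
  have := alM (M + j)%N (kexp (st (M + j)) i) (leq_addr _ _) (kexp_le _ _).
  by move: Gal; rewrite /al; lra.
exists (M + K)%N => m MKm sm im.
have Mm : (M <= m)%N by exact: leq_trans (leq_addr _ _) MKm.
have Ge : G i (kexp (st m) i) <= e / 2.
  have := step (m - M)%N; rewrite subnKC// => /(_ sm im)[//|Kk].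
  apply: le_trans GK; apply: G_nincr_le; apply: leq_trans Kk.
  by rewrite leq_subRL.
have := alM m (kexp (st m) i) Mm (kexp_le _ _).
by rewrite /W /al; move: Ge; lra.
Qed.

(** Stated from the first round on: initially nothing is returned, and a single initial candidate
    does not yet count as stopped. *)
Let st_inv m : exists j, [/\ ret (st m.+1) = Some j, j \in cand (st m.+1) &
  stopped (st m.+1) = (#|cand (st m.+1)| == 1%N)].
Proof.
elim: m => [|m IH].
  by exists (istar 0); split; [exact: ret_istar|exact: istar_cand|].
have [sm|sm] := boolP (stopped (st m.+1)); first by rewrite stS_stopped.
exists (istar m.+1); split; [exact: ret_istar|exact: istar_cand|].
by rewrite (stS _ sm).
Qed.

(** Each suboptimal algorithm leaves once its width and that of [iopt] fit into its gap, and there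
    are finitely many. Stopping is claimed for a unique optimum, since tied optima all remain
    candidates. *)
Lemma eventually_optimal : exists M,
  (forall m, (M <= m)%N -> exists j, ret (st m) = Some j /\ U j = U iopt) /\
  ((forall j, U j = U iopt -> j = iopt) -> stopped (st M)).
Proof.
have cand_le i m m' : (m <= m')%N -> i \in cand (st m') -> i \in cand (st m).
  by move=> /subnK <-; elim: (m' - m)%N => // j IH; rewrite addSn => /cand_decr.
have elim_i i : exists M, i \in cand (st M.+1) -> U i = U iopt.
  have [->|Ui] := eqVneq (U i) (U iopt); first by exists 0%N.
  have D0 : 0 < (U iopt - U i) / 2.
    by rewrite divr_gt0// subr_gt0 lt_neqAle Ui U_max.
  have [M1 W1] := W_small i _ D0; have [M2 W2] := W_small iopt _ D0.
  pose M := maxn M1 M2; exists M => iM.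
  (* If the run has already stopped, its only candidate is [iopt]; otherwise both widths are at most
     half the gap and [i] is eliminated in this round. *)
  have [sM|sM] := boolP (stopped (st M)).
    have [->//|iopt_neq] := eqVneq i iopt.
    have [j [_ _ sj]] := st_inv M.
    move: sj; rewrite stS_stopped// sM => /esym/cards1P[j' cj'].
    have := opt_cand M; rewrite cj' inE => /eqP oj'.
    by move: iM; rewrite stS_stopped// cj' inE -oj' => /eqP ->.
  have := eliminated M i sM; rewrite iM => /implyP; rewrite implybF => /negP[].
  have := W1 M (leq_maxl _ _) sM (cand_decr _ _ iM).
  by have := W2 M (leq_maxr _ _) sM (opt_cand M); lra.
have [N HN] := choice elim_i.
pose M := (\max_i N i).+1; exists M.
have candM m i : (M <= m)%N -> i \in cand (st m) -> U i = U iopt.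
  move=> Mm im; apply: HN; apply: cand_le im; apply: leq_trans Mm.
  by rewrite ltnS (leq_bigmax i).
split=> [[//|m] Mm|uniq_opt].
  have [j [rj cj _]] := st_inv m.
  by exists j; split => //; exact: candM cj.
have [j [_ _ ->]] := st_inv (\max_i N i); apply/cards1P; exists iopt.
apply/setP => i; rewrite inE; apply/idP/eqP => [iM|->]; last exact: opt_cand.
by apply: uniq_opt; exact: (candM M).
Qed.

End good_event.

(** * Capped means, failure probabilities and the union bound *)

Lemma measure_bigsetU_le {R : realType} {d : measure_display}
    {T : measurableType d} (mu : {measure set T -> \bar R}) (I : Type)
    (s : seq I) (A : I -> set T) : (forall i, measurable (A i)) ->
  (mu (\big[setU/set0]_(i <- s) A i) <= \sum_(i <- s) mu (A i))%E.
Proof.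
move=> mA; elim: s => [|i s IH]; first by rewrite !big_nil measure0.
rewrite !big_cons (le_trans (measureU2 _ _ _))// ?leeD2l//.
exact: bigsetU_measurable.
Qed.

Section concentration.
Context {R : realType} {d : measure_display} {Omega : measurableType d}.
Variables (P : probability Omega R) (n : nat) (u : R -> R).
Variables (D : 'I_n -> probability R R) (T : 'I_n -> nat -> nat -> Omega -> R).
Variable delta : R.

Hypothesis n0 : (0 < n)%N.
Hypothesis delta01 : 0 < delta < 1.
Hypothesis u_nincr : forall x y : R, x <= y -> u y <= u x.
Hypothesis u01 : forall x : R, 0 <= u x <= 1.
Hypothesis mT : forall i m j, measurable_fun setT (T i m j).
Hypothesis indT : forall i (s : seq (nat * nat)) (B : nat * nat -> set R),
  uniq s -> (forall p, measurable (B p)) ->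
  P (\big[setI/setT]_(p <- s) (T i p.1 p.2 @^-1` B p)) =
  (\prod_(p <- s) D i (B p))%E.

Let u0 x : 0 <= u x. Proof. by have /andP[] := u01 x. Qed.
Let u1 x : u x <= 1. Proof. by have /andP[] := u01 x. Qed.

Definition capped_util k x := u (Num.min x (captime R k)).

Definition below_captime k (x : R) : R :=
  if Num.min x (captime R k) < captime R k then 1 else 0.

Let mu i k := fine (\int[D i]_x (capped_util k x)%:E).
Let F i k := cdf_lt (D i) (captime R k).

Let measurable_u : measurable_fun setT u.
Proof. by apply: nonincreasing_measurable => // x y; exact: u_nincr. Qed.

Let measurable_capped k : measurable_fun setT (capped_util k).
Proof.
apply: nonincreasing_measurable => // x y xy; apply: u_nincr.
by rewrite le_min !ge_min xy lexx orbT.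
Qed.

Let below_captimeE k : below_captime k = \1_(`]-oo, captime R k[%classic).
Proof.
apply/funext => x; rewrite /below_captime indicE gt_min ltxx orbF.
by case: ifPn => xk; [rewrite mem_set|rewrite memNset] => //=;
  rewrite in_itv/=; exact/negP.
Qed.

Let measurable_below k : measurable_fun setT (below_captime k).
Proof. by rewrite below_captimeE; exact: measurable_indic. Qed.

Let capped01 k x : u (captime R k) <= capped_util k x <= 1.
Proof. by rewrite u1 andbT u_nincr// ge_min lexx orbT. Qed.

Let below01 k x : 0 <= below_captime k x <= 1.
Proof. by rewrite /below_captime; case: ifP; rewrite ?lexx ?ler01. Qed.

Let integral_cst_prob (Q : probability R R) (a : R) :
  (\int[Q]_x a%:E = a%:E)%E.
Proof.
rewrite [LHS](integral_cst Q measurableT a%:E).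
by rewrite -[RHS]mule1; congr (_ * _)%E; exact: probability_setT.
Qed.

Let muE i k : (\int[D i]_x (capped_util k x)%:E = (mu i k)%:E)%E.
Proof.
rewrite /mu fineK// ge0_fin_numE; last first.
  by apply: integral_ge0 => x _; rewrite lee_fin; exact: u0.
rewrite (@le_lt_trans _ _ 1%E) ?ltry// -[leRHS](integral_cst_prob (D i) 1).
apply: ge0_le_integral => //.
- by move=> x _; rewrite lee_fin; exact: u0.
- exact/measurable_EFinP.
- by move=> x _; rewrite lee_fin; exact: u1.
Qed.

Let FE i k : (\int[D i]_x (below_captime k x)%:E = (F i k)%:E)%E.
Proof.
rewrite below_captimeE integral_indic// setIT /F /cdf_lt fineK//.
exact: fin_num_measure.
Qed.

Let UE i : (\int[D i]_x (u x)%:E = (exp_util u (D i))%:E)%E.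
Proof.
rewrite /exp_util fineK// ge0_fin_numE; last first.
  by apply: integral_ge0 => x _; rewrite lee_fin.
rewrite (@le_lt_trans _ _ 1%E) ?ltry// -[leRHS](integral_cst_prob (D i) 1).
apply: ge0_le_integral => //.
- by move=> x _; rewrite lee_fin.
- exact/measurable_EFinP.
- by move=> x _; rewrite lee_fin.
Qed.

Lemma capped_util_bounds i k : u (captime R k) <= mu i k <= 1.
Proof.
rewrite -!lee_fin -muE -[in leLHS](integral_cst_prob (D i)).
rewrite -[X in _ && (_ <= X)%E](integral_cst_prob (D i) 1).
apply/andP; split; apply: ge0_le_integral => //.
- by move=> x _; rewrite lee_fin.
- exact/measurable_EFinP.
- by move=> x _; rewrite lee_fin; have /andP[] := capped01 k x.
- by move=> x _; rewrite lee_fin; exact: u0.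
- exact/measurable_EFinP.
- by move=> x _; rewrite lee_fin; exact: u1.
Qed.

Lemma exp_util_le_capped i k : exp_util u (D i) <= mu i k.
Proof.
rewrite -lee_fin -muE -UE; apply: ge0_le_integral => //.
- by move=> x _; rewrite lee_fin.
- exact/measurable_EFinP.
- exact/measurable_EFinP.
- by move=> x _; rewrite lee_fin u_nincr// ge_min lexx.
Qed.

(** Capping changes the utility only on runs that reach the captime, and there raises it by at most
    [u kappa]. *)
Lemma capped_le_exp_util i k :
  mu i k <= exp_util u (D i) + u (captime R k) * (1 - F i k).
Proof.
have below1 x : below_captime k x <= 1 by have /andP[] := below01 k x.
have below0 x : 0 <= below_captime k x by have /andP[] := below01 k x.
(* Terms are moved so that both sides are integrals of nonnegative functions, compared pointwise. *)
suff : mu i k + u (captime R k) * F i k <= exp_util u (D i) + u (captime R k).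
  by lra.
rewrite -lee_fin !EFinD EFinM -muE -UE -FE.
rewrite -[X in (_ <= _ + X)%E](integral_cst_prob (D i)).
rewrite -ge0_integralZl//; last 3 first.
- exact/measurable_EFinP.
- by move=> x _; rewrite lee_fin.
- by rewrite lee_fin.
rewrite -!ge0_integralD//; last first.
- by apply: emeasurable_funM => //; exact/measurable_EFinP.
- by move=> x _; rewrite mule_ge0// lee_fin.
- exact/measurable_EFinP.
- by move=> x _; rewrite lee_fin; exact: u0.
- by move=> x _; rewrite lee_fin.
- exact/measurable_EFinP.
- by move=> x _; rewrite lee_fin.
apply: ge0_le_integral => //.
- by move=> x _; rewrite adde_ge0 ?mule_ge0 ?lee_fin//; exact: u0.
- apply: emeasurable_funD; first exact/measurable_EFinP.
  by apply: emeasurable_funM => //; exact/measurable_EFinP.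
- by apply: emeasurable_funD => //; exact/measurable_EFinP.
- move=> x _; rewrite -EFinM -!EFinD lee_fin /capped_util /below_captime.
  have [xk|kx] := ltP x (captime R k).
    by rewrite xk mulr1.
  by rewrite ltxx mulr0 addr0 lerDr.
Qed.

Let t m w i j := T i m j w.
Let al m k : R := alpha n delta m k.

(* When [u kappa = 1] the capped utility is constant and its deviation bound is
   [0 <= 0], which must not count as a failure; excluding that case keeps the
   bounds strict off the event, which strict elimination in (3) requires. *)
Definition util_deviates i m k : set Omega :=
  [set w | u (captime R k) < 1 /\
    (1 - u (captime R k)) * al m k <= `|Uhat u (t m w) i m k - mu i k|].

Definition cdf_deviates i m k : set Omega :=
  [set w | al m k <= `|Fhat (t m w) i m k - F i k|].

Let round m := [seq (m, j) | j <- index_iota 0 m].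

Let uniq_round m : uniq (round m).
Proof. by rewrite map_inj_uniq ?iota_uniq// => i j []. Qed.

Let size_round m : size (round m) = m.
Proof. by rewrite size_map size_iota subn0. Qed.

Let sum_round i m (h : R -> R) w :
  \sum_(p <- round m) h (T i p.1 p.2 w) = \sum_(j < m) h (T i m j w).
Proof. by rewrite big_map big_mkord. Qed.

Let dev_mean (S c y : R) m :
  (y <= `|S / m.+1%:R - c|) = (y *+ m.+1 <= `|S - c *+ m.+1|).
Proof.
rewrite -[in RHS](mulr_natr y) -[in RHS](mulr_natr c).
rewrite -[S in RHS](@divfK _ m.+1%:R)// -mulrBl normrM [`|m.+1%:R|]ger0_norm//.
by rewrite ler_pM2r.
Qed.

Let util_deviatesE i m k : u (captime R k) < 1 -> util_deviates i m.+1 k =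
  [set w | ((1 - u (captime R k)) * al m.+1 k) *+ size (round m.+1) <=
    `|\sum_(p <- round m.+1) capped_util k (T i p.1 p.2 w)
      - mu i k *+ size (round m.+1)|].
Proof.
move=> uk; apply/seteqP; split => w;
  rewrite /util_deviates /mkset sum_round size_round -dev_mean; first by case.
by [].
Qed.

Let cdf_deviatesE i m k : cdf_deviates i m.+1 k =
  [set w | ((1 - 0) * al m.+1 k) *+ size (round m.+1) <=
    `|\sum_(p <- round m.+1) below_captime k (T i p.1 p.2 w)
      - F i k *+ size (round m.+1)|].
Proof.
by apply/seteqP; split => w;
  rewrite /cdf_deviates /mkset sum_round size_round -dev_mean subr0 mul1r.
Qed.

Let util_deviates0 i m k : ~ u (captime R k) < 1 -> util_deviates i m k = set0.
Proof. by move=> uk; apply/seteqP; split => w // [/uk]. Qed.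

Let measurable_dev i m (h : R -> R) (y c : R) : measurable_fun setT h ->
  measurable [set w | y <= `|\sum_(p <- round m) h (T i p.1 p.2 w) - c|].
Proof.
move=> mh; apply: measurable_superlevel; apply: measurableT_comp => //.
apply: measurable_funB => //.
by apply: (measurable_sum_comp (fun p => T i p.1 p.2)).
Qed.

Let measurable_util_deviates i m k : measurable (util_deviates i m.+1 k).
Proof.
have [uk|uk] := pselect (u (captime R k) < 1).
  by rewrite util_deviatesE//; exact: measurable_dev.
by rewrite util_deviates0.
Qed.

Let measurable_cdf_deviates i m k : measurable (cdf_deviates i m.+1 k).
Proof. by rewrite cdf_deviatesE; exact: measurable_dev. Qed.

(** The one-sided Hoeffding tail at radius [alpha] in round [m.+1]. *)
Let tail m k : R := delta / (11 * n%:R) / m.+1%:R ^+ 2 / k.+1%:R ^+ 2.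

Let delta_n_ge0 : 0 <= delta / (11 * n%:R).
Proof. by case/andP: delta01 => d0 _; rewrite divr_ge0// ltW. Qed.

Let tail_ge0 m k : 0 <= tail m k.
Proof. by rewrite /tail divr_ge0 ?exprn_ge0// divr_ge0 ?exprn_ge0. Qed.

Let util_deviates_le i m k : (P (util_deviates i m.+1 k) <= (2 * tail m k)%:E)%E.
Proof.
have [uk|uk] := pselect (u (captime R k) < 1); last first.
  by rewrite util_deviates0// measure0 lee_fin mulr_ge0.
rewrite util_deviatesE//.
have := hoeffding_indep_abs P (fun p => T i p.1 p.2) (D i)
  (fun p => mT i p.1 p.2) (@indT i) _ _ _ _ (al m.+1 k) (round m.+1)
  (measurable_capped k) (u0 _) uk (capped01 k) (muE i k) (uniq_round _).
rewrite ltW ?alpha_gt0// size_round /al expR_alpha//.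
exact.
Qed.

Let cdf_deviates_le i m k : (P (cdf_deviates i m.+1 k) <= (2 * tail m k)%:E)%E.
Proof.
rewrite cdf_deviatesE.
have := hoeffding_indep_abs P (fun p => T i p.1 p.2) (D i)
  (fun p => mT i p.1 p.2) (@indT i) _ _ _ _ (al m.+1 k) (round m.+1)
  (measurable_below k) (lexx 0) ltr01 (below01 k) (FE i k) (uniq_round _).
rewrite ltW ?alpha_gt0// size_round /al expR_alpha//.
exact.
Qed.

Let deviates i m k := util_deviates i m.+1 k `|` cdf_deviates i m.+1 k.

Let measurable_deviates i m k : measurable (deviates i m k).
Proof. exact: measurableU. Qed.

(* Numerically, [4 * 1.65^2 <= 11]. *)
Lemma concentration_event : exists Bad : set Omega, [/\ measurable Bad,
  (P Bad <= delta%:E)%E &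
  forall i m k, util_deviates i m.+1 k `|` cdf_deviates i m.+1 k `<=` Bad].
Proof.
pose Bad_i i := \bigcup_m \bigcup_k deviates i m k.
have mk i m : measurable (\bigcup_k deviates i m k) by exact: bigcup_measurable.
have mBad_i i : measurable (Bad_i i) by exact: bigcup_measurable.
have PBad_i i : (P (Bad_i i) <= (delta / n%:R)%:E)%E.
  (* Two deviation events, each with two tails. *)
  pose c := 4 * (delta / (11 * n%:R)).
  have c0 : 0 <= c by rewrite mulr_ge0.
  apply: (le_trans (generalized_Boole_inequality _ (mk i) (mBad_i i))).
  apply: (@le_trans _ _ (33 / 20 * (33 / 20 * c))%:E).
    apply: nneseries_inv_sqr_le => // [|m]; first by rewrite mulr_ge0.
    apply: (le_trans (generalized_Boole_inequality _
      (measurable_deviates i m) (mk i m))).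
    rewrite -(mulrA (33 / 20)).
    apply: nneseries_inv_sqr_le => // [|k]; first by rewrite divr_ge0// exprn_ge0.
    rewrite (le_trans (measureU2 _ _ _))//.
    rewrite (le_trans (leeD (util_deviates_le _ _ _) (cdf_deviates_le _ _ _)))//.
    by rewrite -EFinD lee_fin /c -!(mulrA 4) -/(tail m k); lra.
  rewrite lee_fin /c invfM; have : 0 <= delta / n%:R.
    by case/andP: delta01 => d0 _; rewrite divr_ge0// ltW.
  by lra.
exists (\big[setU/set0]_(i : 'I_n) Bad_i i); split.
- exact: bigsetU_measurable.
- rewrite (le_trans (measure_bigsetU_le _ _ _ _ _))//.
  rewrite (le_trans (lee_sum _ (fun i _ => PBad_i i)))//.
  rewrite sumEFin sumr_const card_ord -(mulr_natr (delta / _)) divfK//.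
  by rewrite pnatr_eq0 -lt0n.
- move=> i m k w wd; rewrite (bigD1 i)//=; left.
  by exists m => //; exists k.
Qed.

End concentration.

(** * Arithmetic of the confidence bounds and the final assembly *)

Lemma Uhat_bounds {R : realType} {n : nat} (u : R -> R) (t : 'I_n -> nat -> R)
    (i : 'I_n) (m k : nat) :
  (forall x y : R, x <= y -> u y <= u x) -> (forall x : R, u x <= 1) ->
  u (captime R k) <= Uhat u t i m.+1 k <= 1.
Proof.
move=> u_nincr u1; rewrite /Uhat ler_pdivlMr// ler_pdivrMr// mul1r mulr_natr.
have sumE (a : R) : a *+ m.+1 = \sum_(j < m.+1) a by rewrite sumr_const card_ord.
rewrite (sumE (u _)) (sumE 1).
apply/andP; split; apply: ler_sum => j _ //.
by apply: u_nincr; rewrite ge_min lexx orbT.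
Qed.

(** Here [x] and [mu] are the empirical and true capped utilities, [v] is [u kappa], and [Fh], [F]
    are the empirical and true CDF values. The conclusions are the five bounds required by the
    deterministic analysis. *)
Lemma confidence_bounds {R : realType} (x mu v al Fh F U : R) :
  0 <= v <= 1 -> 0 < al -> v <= x <= 1 -> v <= mu <= 1 ->
  U <= mu -> mu <= U + v * (1 - F) ->
  ~ (v < 1 /\ (1 - v) * al <= `|x - mu|) -> ~ (al <= `|Fh - F|) ->
  [/\ x - al - v * (1 - Fh) <= U, U <= x + (1 - v) * al,
      x + (1 - v) * al < U + (2 * al + v * (1 - F)),
      U - (2 * al + v * (1 - F)) < x - al - v * (1 - Fh) &
      ~~ (2 * al <= v * (1 - Fh)) -> v * (1 - F) <= 3 * al].
Proof.
move=> /andP[v0 v1] al0 /andP[vx x1] /andP[vmu mu1] Umu muU ndev.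
move=> /negP; rewrite -ltNge ltr_norml => /andP[F1 F2].
(* These products are the only nonlinear facts; with them the rest is linear. *)
have vF1 : 0 <= v * (al - (Fh - F)) by rewrite mulr_ge0//; lra.
have vF2 : 0 <= v * (al + (Fh - F)) by rewrite mulr_ge0//; lra.
have val : v * al <= al by rewrite ler_piMl// ltW.
have [v_lt1|v_ge1] := ltP v 1.
  have : `|x - mu| < (1 - v) * al.
    by rewrite ltNge; apply/negP => xmu; apply: ndev.
  rewrite ltr_norml => /andP[X1 X2].
  by split; [lra|lra|lra|lra|rewrite -ltNge; lra].
(* In the degenerate case all capped utilities equal 1, so [x] and [mu] agree and [al > 0] alone
   gives strictness. *)
have ve : v = 1 by apply/eqP; rewrite eq_le v1.
have xe : x = 1 by apply/eqP; rewrite eq_le x1 -ve.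
have mue : mu = 1 by apply/eqP; rewrite eq_le mu1 -ve.
subst v x mu.
by split; [lra|lra|lra|lra|rewrite -ltNge; lra].
Qed.

Theorem theorem4 (R : realType) (d : measure_display) (Omega : measurableType d)
  (P : probability Omega R) (n : nat) (u : R -> R)
  (D : 'I_n -> probability R R) (T : 'I_n -> nat -> nat -> Omega -> R)
  (delta : R) (sel : {set 'I_n} -> ('I_n -> R) -> 'I_n) (iopt : 'I_n) :
  (0 < n)%N ->
  (forall x y : R, x <= y -> u y <= u x) ->
  (forall x : R, 0 <= u x <= 1) ->
  u 0 = 1 ->
  u x @[x --> +oo] --> 0 ->
  (forall i, D i `]-oo, 0[%classic = 0%E) ->
  (forall i m j, measurable_fun setT (T i m j)) ->
  (forall i (s : seq (nat * nat)) (B : nat * nat -> set R),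
      uniq s -> (forall p, measurable (B p)) ->
      P (\big[setI/setT]_(p <- s) (T i p.1 p.2 @^-1` B p)) =
      (\prod_(p <- s) D i (B p))%E) ->
  0 < delta < 1 ->
  (forall (I : {set 'I_n}) (f : 'I_n -> R), (0 < #|I|)%N ->
      sel I f \in I /\ forall j, j \in I -> f j <= f (sel I f)) ->
  (forall j, exp_util u (D j) <= exp_util u (D iopt)) ->
  exists E : set Omega, measurable E /\ (1 - delta%:E <= P E)%E /\
  forall w, E w ->
    let run := up_run u delta sel (fun i m j => T i m j w) in
    let U := fun j => exp_util u (D j) in
    let F := fun j x => cdf_lt (D j) x in
    (* (1) UP eventually returns an optimal algorithm *)
    (exists M, (forall m, (M <= m)%N ->
                  exists j, ret (run m) = Some j /\ U j = U iopt) /\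
               ((forall j, U j = U iopt -> j = iopt) -> stopped (run M))) /\
    (* (2) returning at the end of round m.+1 *)
    (forall (m : nat) (eps : R), ~~ stopped (run m) ->
       let k := kexp (run m) iopt in
       2 * alpha n delta m.+1 k + u (captime R k) * (1 - F iopt (captime R k)) <= eps ->
       exists j, ret (run m.+1) = Some j /\ U iopt - eps <= U j) /\
    (* (3) elimination of suboptimal algorithms in round m.+1 *)
    (forall (i : 'I_n) (m : nat), U i < U iopt -> ~~ stopped (run m) ->
       let ki := kexp (run m) i in
       let ko := kexp (run m) iopt in
       2 * alpha n delta m.+1 ki + 2 * alpha n delta m.+1 ko
         + u (captime R ki) * (1 - F i (captime R ki))
         + u (captime R ko) * (1 - F iopt (captime R ko)) <= U iopt - U i ->
       i \notin cand (run m.+1)).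
Proof.
move=> n0 u_nincr u01 _ u_cvg0 _ mT indT delta01 selP U_max.
have u0 x : 0 <= u x by have /andP[] := u01 x.
have u1 x : u x <= 1 by have /andP[] := u01 x.
have [Bad [mBad PBad devBad]] :=
  concentration_event P n u D T delta n0 delta01 u_nincr u01 mT indT.
exists (~` Bad); split; first exact: measurableC.
split; first by rewrite probability_setC// leeB.
move=> w wBad run U F.
pose G i k := u (captime R k) * (1 - F i (captime R k)).
have F_le1 i x : F i x <= 1.
  by rewrite /F /cdf_lt -lee_fin fineK ?probability_le1// fin_num_measure.
have F_ndecr i k : F i (captime R k) <= F i (captime R k.+1).
  rewrite /F /cdf_lt fine_le ?fin_num_measure//.
  rewrite le_measure ?inE//= => x /=; rewrite !in_itv/= => xk.
  by rewrite (lt_le_trans xk)// /captime ler_eXn2l// ltr1n.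
have conf i m k := @confidence_bounds R
  (Uhat u (fun i => T i m.+1 ^~ w) i m.+1 k)
  (fine (\int[D i]_x (capped_util u k x)%:E))
  (u (captime R k)) (alpha n delta m.+1 k)
  (Fhat (fun i => T i m.+1 ^~ w) i m.+1 k)
  (F i (captime R k)) (U i) (u01 _) (alpha_gt0 n delta n0 delta01 m k)
  (Uhat_bounds u _ _ _ _ u_nincr u1)
  (capped_util_bounds n u D u_nincr u01 i k)
  (exp_util_le_capped n u D u_nincr u01 i k)
  (capped_le_exp_util n u D u_nincr u01 i k)
  (fun dev => wBad (devBad i m k w (or_introl dev)))
  (fun dev => wBad (devBad i m k w (or_intror dev))).
have G_nincr i k : G i k.+1 <= G i k.
  apply: ler_pM => //; first by rewrite subr_ge0.
    by apply: u_nincr; rewrite /captime ler_eXn2l ?ltr1n.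
  by rewrite lerD2l lerN2.
have G_small i (e : R) : 0 < e -> exists K, G i K <= e.
  move=> e0; have [M [_ uM]] : \forall x \near +oo, u x < e.
    exact: (cvgr_lt 0 u_cvg0).
  (* Since [2 ^ K > K], an exponent beyond the threshold [M] puts the captime beyond it too; the
     factor [1 - F] is at most 1. *)
  exists (Num.bound `|M|); rewrite /G.
  apply: (@le_trans _ _ (u (captime R (Num.bound `|M|)))).
    by rewrite ler_piMr// lerBlDr lerDl fine_ge0.
  apply: ltW; apply: uM; rewrite /captime.
  rewrite (le_lt_trans (ler_norm _))// (lt_trans (archi_boundP _))//.
  by rewrite -natrX ltr_nat ltn_expl.
have h1 i m k := let: And5 h _ _ _ _ := conf i m k in h.
have h2 i m k := let: And5 _ h _ _ _ := conf i m k in h.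
have h3 i m k := let: And5 _ _ h _ _ := conf i m k in h.
have h4 i m k := let: And5 _ _ _ h _ := conf i m k in h.
have h5 i m k := let: And5 _ _ _ _ h := conf i m k in h.
split; [|split].
- exact: (eventually_optimal u delta sel iopt
    (fun i m j => T i m j w) U G n0 delta01 selP U_max h1 h2 h3 h4 h5).
- move=> m eps sm k We.
  exact: (ret_eps_optimal u delta sel iopt
    (fun i m j => T i m j w) U G).
- move=> i m Ui sm ki ko Wi.
  apply: (eliminated u delta sel iopt (fun i m j => T i m j w) U G) => //.
  by move: Wi; rewrite /G; lra.
Qed.
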